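(* Let $0 = k_0 < k_1 < \dots < k_p < k_{p+1} = n$ be integers and let $b_1,\dots,b_{p+1} \in \mathbb{R}$ be distinct. Let $\operatorname{Flag}_{b_1,\dots,b_{p+1}}(k_1,\dots,k_p,n)$ be the isospectral model of the flag manifold, i.e. the real affine variety \[ \operatorname{Flag}_{b_1,\dots,b_{p+1}}(k_1,\dots,k_p,n) := \Bigl\{X\in\mathsf{S}^2(\mathbb{R}^n): \prod_{j=0}^{p}(X-b_{j+1}I_n)=0,\ \operatorname{tr}(X)=\sum_{j=0}^{p}(k_{j+1}-k_j)b_{j+1}\Bigr\}. \] Then its Euclidean distance degree is \[ \mathsf{ED}\bigl(\operatorname{Flag}_{b_1,\dots,b_{p+1}}(k_1,\dots,k_p,n)\bigr) = \binom{n}{k_1,\,k_2-k_1,\,\dots,\,n-k_p}. \]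
   Context: For $\mathbb{F}=\mathbb{R}$ or $\mathbb{C}$, $\mathsf{S}^2(\mathbb{F}^n)=\{X\in\mathbb{F}^{n\times n}: X^{\mathsf T}=X\}$ and $\mathrm{O}_n(\mathbb{F})=\{X\in\mathbb{F}^{n\times n}:X^{\mathsf T}X=I\}$ (for $\mathbb{F}=\mathbb{C}$: complex symmetric and complex orthogonal matrices, with transpose and not conjugate transpose). The right-hand side is the multinomial coefficient $n!/\prod_{j=0}^{p}(k_{j+1}-k_j)!$. Isospectral model: it is defined by the equations in the claim, and is stated to have the second description \[ \operatorname{Flag}_{b_1,\dots,b_{p+1}}(k_1,\dots,k_p,n)=\bigl\{V\operatorname{diag}(b_1 I_{k_1}, b_2 I_{k_2-k_1},\dots,b_{p+1}I_{n-k_p})V^{\mathsf T}: V\in \mathrm{O}_n(\mathbb{R})\bigr\}. \] Its complex locus is the set of complex solutions of the same defining equations, \[ \operatorname{Flag}_{b_1,\dots,b_{p+1}}(k_1,\dots,k_p,n)^{\mathbb{C}}=\Bigl\{X\in\mathsf{S}^2(\mathbb{C}^n): \prod_{j=0}^{p}(X-b_{j+1}I_n)=0,\ \operatorname{tr}(X)=\sum_{j=0}^{p}(k_{j+1}-k_j)b_{j+1}\Bigr\}. \] Euclidean distance degree: for a real affine variety $\mathcal{M}\subseteq \mathsf{S}^2(\mathbb{R}^n)$ with complex locus $\mathcal{M}^{\mathbb{C}}$ (the complex solutions of its defining equations), $\mathsf{ED}(\mathcal{M})$ is the number of stationary points of $\delta_A:\mathcal{M}^{\mathbb{C}}\to\mathbb{C}$,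 $\delta_A(X)=\tfrac12\sum_{i,j}(x_{ij}-a_{ij})^2$ (no absolute values), for a generic $A=(a_{ij})\in \mathsf{S}^2(\mathbb{R}^n)$. A point $X\in\mathcal{M}^{\mathbb{C}}$ is stationary if $\operatorname{tr}(Y^{\mathsf T}(X-A))=0$ for all $Y$ in the tangent space of $\mathcal{M}^{\mathbb{C}}$ at $X$.
   Formalization: The formal theorem also assumes that the real solutions of the equations are exactly the orthogonal orbit of diag(b_1 I, ..., b_{p+1} I); without this the claim fails, e.g. n=3, k=(0,1,2,3), b=(0,1,2), where X=I is an extra point and ED is 7, not 6. *)

(* Defs.v *)
From mathcomp Require Import all_boot all_order all_algebra reals.
From mathcomp Require Import complex.
From mathcomp Require Import mpoly.

Set Implicit Arguments.
Unset Strict Implicit.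
Unset Printing Implicit Defensive.

Import GRing.Theory.
Local Open Scope ring_scope.

(* Polynomials on n x n matrices are elements of {mpoly F[n * n]}, the variable
   of index i being the i-th entry of the row-major vectorization mxvec. *)
Definition mxcoord (F : fieldType) (n : nat) (X : 'M[F]_n) : 'I_(n * n) -> F :=
  fun i => mxvec X 0 i.

(* d f_X (Y), the differential of f at X in the direction Y *)
Definition mxdiff (F : fieldType) (n : nat) (f : {mpoly F[n * n]})
    (X Y : 'M[F]_n) : F :=
  \sum_(i < n * n) (f^`M(i)).@[mxcoord X] * mxcoord Y i.

(* Zariski tangent space at X of the algebraic set V: the common kernel of the
   differentials at X of all polynomials vanishing on V. *)
Definition tangent_space (F : fieldType) (n : nat) (V : 'M[F]_n -> Prop)
    (X Y : 'M[F]_n) : Prop :=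
  forall f : {mpoly F[n * n]},
    (forall Z : 'M[F]_n, V Z -> f.@[mxcoord Z] = 0) -> mxdiff f X Y = 0.

Definition stationary (F : fieldType) (n : nat) (V : 'M[F]_n -> Prop)
    (A X : 'M[F]_n) : Prop :=
  V X /\ forall Y : 'M[F]_n, tangent_space V X Y -> \tr (Y^T *m (X - A)) = 0.

Definition has_card (T : eqType) (S : T -> Prop) (N : nat) : Prop :=
  exists s : seq T, [/\ uniq s, size s = N & forall x, x \in s <-> S x].

(* "P A holds for a generic A in S^2(R^n)": P holds off the zero set of a
   polynomial that is not identically zero on the symmetric matrices. *)
Definition generic_sym (F : fieldType) (n : nat) (P : 'M[F]_n -> Prop) : Prop :=
  exists g : {mpoly F[n * n]},
    (exists A : 'M[F]_n, A^T = A /\ g.@[mxcoord A] != 0) /\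
    (forall A : 'M[F]_n, A^T = A -> g.@[mxcoord A] != 0 -> P A).

(* ED(M) = N, where MC is the complex locus of M. The data matrix A is real and
   is embedded entrywise in the complex matrices. *)
Definition ED_degree (R : realType) (n : nat) (MC : 'M[R[i]]_n -> Prop)
    (N : nat) : Prop :=
  generic_sym (fun A : 'M[R]_n =>
    has_card (stationary MC (map_mx (real_complex R) A)) N).

(* The defining equations of the isospectral model, over an arbitrary field F:
   F = R gives the real variety and F = R[i] its complex locus. The indexing of
   k is k 0 = 0 < k 1 < ... < k p < k p.+1 = n, and b j is b_{j+1}. *)
Definition flag_model (F : fieldType) (p : nat) (k : nat -> nat) (n : nat)
    (b : 'I_p.+1 -> F) (X : 'M[F]_n) : Prop :=
  [/\ X^T = X,
      \prod_(j < p.+1) (X - (b j)%:M) = 0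
    & \tr X = \sum_(j < p.+1) (k j.+1 - k j)%:R * b j].

Definition flag_complex_locus (R : realType) (p : nat) (k : nat -> nat)
    (n : nat) (b : 'I_p.+1 -> R) : 'M[R[i]]_n -> Prop :=
  flag_model k (fun j => real_complex R (b j)).

(* diag(b_1 I_{k_1}, b_2 I_{k_2 - k_1}, ..., b_{p+1} I_{n - k_p}): each i < n
   lies in exactly one of the intervals [k j, k j.+1), so that the sum below
   has a single term. *)
Definition flag_diag (F : fieldType) (p : nat) (k : nat -> nat) (n : nat)
    (b : 'I_p.+1 -> F) : 'M[F]_n :=
  diag_mx (\row_(i < n) \sum_(j < p.+1 | (k j <= i < k j.+1)%N) b j).

(* This need not coincide with flag_model: for n = 3, k = (0, 1, 2, 3) and
   b = (0, 1, 2), the identity matrix satisfies the equations of flag_model.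
   The two agree over R iff no other multiplicities of the b j (with sum n)
   yield the same trace. *)
Definition flag_orbit (F : fieldType) (p : nat) (k : nat -> nat) (n : nat)
    (b : 'I_p.+1 -> F) (X : 'M[F]_n) : Prop :=
  exists V : 'M[F]_n, V^T *m V = 1%:M /\ X = V *m flag_diag k n b *m V^T.

(* Main.v *)
Require Import Defs.
From mathcomp Require Import all_boot all_order all_algebra reals.
From mathcomp Require Import complex.
From mathcomp Require Import mpoly.
From mathcomp Require Import separable ring.

(* Let A be symmetric with separable characteristic polynomial, which is the
   nonvanishing of a discriminant. Then X is stationary iff it commutes with A.
   If X is stationary, test it against the velocities JX - XJ (J skew) of the
   curves R(t) X R(t)^T with R(t) orthogonal and rational in t: tr(J[A, X]) = 0.
   Conversely, in an eigenbasis of A the differential of prod_j (X - b_j) has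
   diagonal entries q'(d_i) Y_ii, where q = prod_j ('X - b_j) and the d_i are the
   eigenvalues of X; as q is separable, a tangent Y has zero diagonal there, so it
   is orthogonal to X - A, which is diagonal. Hence the stationary points are the
   assignments of the b_j to the n eigenlines of A that satisfy the trace
   equation, i.e. that have the prescribed multiplicities. *)

Import Order.TTheory GRing.Theory Num.Theory.

(** * Differentials of polynomials and their jets along rational curves *)

Section Differential.
Local Open Scope ring_scope.
Set Implicit Arguments.
Unset Strict Implicit.
Variables (F : fieldType) (n : nat).
Implicit Types (X Y : 'M[F]_n) (f g : {mpoly F[n * n]}).

Lemma mxdiffD X Y f g : mxdiff (f + g) X Y = mxdiff f X Y + mxdiff g X Y.
Proof.
rewrite /mxdiff -big_split; apply: eq_bigr => i _ /=.
by rewrite mderivD mevalD mulrDl.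
Qed.

Lemma mxdiffM X Y f g : mxdiff (f * g) X Y =
  mxdiff f X Y * g.@[mxcoord X] + f.@[mxcoord X] * mxdiff g X Y.
Proof.
rewrite /mxdiff mulr_suml mulr_sumr -big_split; apply: eq_bigr => i _ /=.
by rewrite mderivM mevalD !mevalM; ring.
Qed.

Lemma mxdiffC X Y c : mxdiff c%:MP X Y = 0.
Proof. by apply: big1 => i _; rewrite mderivC meval0 mul0r. Qed.

Lemma mxdiffU X Y i : mxdiff 'X_i X Y = mxcoord Y i.
Proof.
rewrite /mxdiff (bigD1 i) //= big1 => [|j ne_ji]; rewrite mderivX mnm1E.
  rewrite eqxx scale1r addr0.
  have ->: (U_(i) - U_(i))%MM = 0%MM by apply/mnmP=> j; rewrite mnmBE mnm0E subnn.
  by rewrite mpolyX0 meval1 mul1r.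
by rewrite eq_sym (negbTE ne_ji) scale0r meval0 mul0r.
Qed.

(** The existence of a jet is stable under sums and products, so constants and variables suffice to
    prove it for all polynomials. *)
Lemma mpoly_ring_ind (m : nat) (P : {mpoly F[m]} -> Prop) :
    (forall c, P c%:MP) -> (forall i, P 'X_i) ->
    (forall p q, P p -> P q -> P (p + q)) ->
    (forall p q, P p -> P q -> P (p * q)) -> forall p, P p.
Proof.
move=> PC PU PD PM; elim/mpolyind=> [|c e p _ _ Pp].
  by rewrite -mpolyC0.
apply: (PD) => //; rewrite -mul_mpolyC; apply: (PM) => //.
rewrite mpolyXE_id; apply: big_ind => [||i _]; [by rewrite -mpolyC1 | exact: PM |].
elim: (e i) => [|k IHk]; first by rewrite expr0 -mpolyC1.
by rewrite exprS; apply: PM.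
Qed.

(* The 1-jet at t = 0 of f along the curve N(t) / d(t). Clearing the denominator
   by a power of d does not change it, since d = 1 + O(t^2). *)
Lemma rational_jet (d : {poly F}) (N : 'M[{poly F}]_n) :
    d.[0] = 1 -> d^`().[0] = 0 ->
  forall f, exists m (P : {poly F}),
   [/\ forall t, d.[t] != 0 ->
         P.[t] = d.[t] ^+ m * f.@[mxcoord (d.[t]^-1 *: map_mx (horner_eval t) N)],
       P.[0] = f.@[mxcoord (map_mx (horner_eval 0) N)]
     & P^`().[0] = mxdiff f (map_mx (horner_eval 0) N)
                     (map_mx (horner_eval 0) (map_mx (@deriv F) N))].
Proof.
move=> d0 d'0; set X0 := map_mx _ N; set Y0 := map_mx _ (map_mx _ _).
apply: mpoly_ring_ind => [c|i|f g|f g].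
- exists 0, c%:P; split=> [t _||].
  + by rewrite expr0 mul1r mevalC hornerC.
  + by rewrite mevalC hornerC.
  + by rewrite mxdiffC derivC horner0.
- exists 1, (mxvec N 0 i); split=> [t dt||].
  + rewrite mevalXU /mxcoord; case/mxvec_indexP: i => u v.
    by rewrite !mxvecE !mxE expr1 mulVKf.
  + by rewrite mevalXU /mxcoord; case/mxvec_indexP: i => u v; rewrite !mxvecE !mxE.
  + rewrite mxdiffU /mxcoord; case/mxvec_indexP: i => u v.
    by rewrite !mxvecE !mxE.
- move=> [m1 [P1 [e1 z1 y1]]] [m2 [P2 [e2 z2 y2]]].
  (* Both summands are put over the denominator [d ^+ (m1 + m2)]; at 0 the derivatives of the powers
     of [d] vanish. *)
  exists (m1 + m2)%N, (d ^+ m2 * P1 + d ^+ m1 * P2); split=> [t dt||].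
  + by rewrite !hornerE e1 // e2 // mevalD exprD; ring.
  + by rewrite !hornerE d0 !expr1n z1 z2 mevalD !mul1r.
  + rewrite derivD !derivM !deriv_exp.
    rewrite !hornerE !hornerMn !hornerE d0 d'0 y1 y2 !expr1n mxdiffD.
    by rewrite !(mul0r, mulr0, mul0rn, mul1r) /= add0r addr0.
- move=> [m1 [P1 [e1 z1 y1]]] [m2 [P2 [e2 z2 y2]]].
  exists (m1 + m2)%N, (P1 * P2); split=> [t dt||].
  + by rewrite !hornerE e1 // e2 // mevalM exprD; ring.
  + by rewrite !hornerE z1 z2 mevalM.
  + by rewrite derivM !hornerE z1 z2 y1 y2 mxdiffM.
Qed.

End Differential.

(** * Tangent vectors from rational curves *)

Section Curve.
Local Open Scope ring_scope.
Set Implicit Arguments.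
Unset Strict Implicit.
Variables (F : numFieldType) (n : nat).

Lemma poly_eq0_pointwise (P : {poly F}) : (forall t, P.[t] = 0) -> P = 0.
Proof.
move=> P0; apply/eqP/negPn/negP=> nzP.
(* In characteristic zero these are [size P] distinct roots, one more than the degree allows. *)
have := @max_poly_roots F P [seq i%:R | i <- iota 0 (size P)] nzP.
rewrite size_map size_iota ltnn.
case/(_ _ _)/Wrap=> //; first by apply/allP=> t _; apply/rootP/P0.
by rewrite map_inj_uniq ?iota_uniq // => i j /eqP; rewrite eqr_nat => /eqP.
Qed.

(** If [f] vanishes on [V], its numerator [P] along the curve vanishes wherever [d] does not, so
    [d * P] has only zero values. Hence [P = 0], and its derivative at 0 is the differential of
    [f]. *)
Lemma tangent_curve (V : 'M[F]_n -> Prop) (d : {poly F}) (N : 'M[{poly F}]_n) :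
    d.[0] = 1 -> d^`().[0] = 0 ->
    (forall t, d.[t] != 0 -> V (d.[t]^-1 *: map_mx (horner_eval t) N)) ->
  tangent_space V (map_mx (horner_eval 0) N)
    (map_mx (horner_eval 0) (map_mx (@deriv F) N)).
Proof.
move=> d0 d'0 VN f fV0.
have [m [P [eP _ <-]]] := rational_jet N d0 d'0 f.
suff -> : P = 0 by rewrite linear0 horner0.
have dP0 : d * P = 0.
  apply: poly_eq0_pointwise => t; rewrite hornerM.
  have [->|dt] := eqVneq d.[t] 0; first by rewrite mul0r.
  by rewrite eP // fV0 ?mulr0 //; apply: VN.
move/eqP: dP0; rewrite mulf_eq0 => /orP[/eqP d_0|/eqP //].
by move: d0; rewrite d_0 horner0 => /eqP; rewrite eq_sym oner_eq0.
Qed.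

Lemma deriv_mulmx (p q r : nat) (A : 'M[{poly F}]_(p, q)) (B : 'M_(q, r)) :
  map_mx (@deriv F) (A *m B) =
  map_mx (@deriv F) A *m B + A *m map_mx (@deriv F) B.
Proof.
apply/matrixP=> i j; rewrite !mxE raddf_sum -big_split /=.
by apply: eq_bigr => l _; rewrite derivM !mxE.
Qed.

(* (1 + t^2) R(t), where R(t) = (1 - tJ)^-1 (1 + tJ) is the Cayley transform of
   tJ; when J^3 = -J it equals 1 + (2t / (1 + t^2)) (J + t J^2). *)
Definition cayley (J : 'M[F]_n) : 'M[{poly F}]_n :=
  (1 + 'X^2)%:M + (2%:R *: 'X) *: map_mx polyC J
  + (2%:R *: 'X^2) *: map_mx polyC (J *m J).

Lemma cayley_eval (J : 'M[F]_n) t : map_mx (horner_eval t) (cayley J) =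
  (1 + t ^+ 2)%:M + (2%:R * t) *: J + (2%:R * t ^+ 2) *: (J *m J).
Proof.
apply/matrixP=> i j; rewrite !mxE /horner_eval !hornerE hornerMn !hornerE /=; ring.
Qed.

Lemma cayley_deriv0 (J : 'M[F]_n) :
  map_mx (horner_eval 0) (map_mx (@deriv F) (cayley J)) = 2%:R *: J.
Proof.
apply/matrixP=> i j; rewrite !mxE /horner_eval.
by rewrite !derivE !hornerE !hornerMn !hornerE /= !mul0rn add0r !addr0.
Qed.

(** With a = 1 + t^2 the product is (a + 2t^2 J^2)^2 - 4t^2 J^2. As J^4 = -J^2, the coefficient of
    J^2 is 4at^2 - 4t^4 - 4t^2 = 0. *)
Lemma cayley_orthogonal (J : 'M[F]_n) t :
    J^T = - J -> J *m J *m J = - J ->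
  let C := map_mx (horner_eval t) (cayley J) in
  C^T *m C = ((1 + t ^+ 2) ^+ 2)%:M.
Proof.
move=> JT J3 C; rewrite /C !cayley_eval.
have J3' : J *m (J *m J) = - J by rewrite mulmxA.
have J4 : J *m J *m (J *m J) = - (J *m J) by rewrite mulmxA J3 mulNmx.
rewrite !linearD !linearZ /= tr_scalar_mx trmx_mul JT mulmxN mulNmx opprK.
rewrite -[X in _ = X]scalemx1 -[(1 + t ^+ 2)%:M]scalemx1 !mulmxDl -!scalemxAl !(mulmxN, mulNmx) -!scalemxAr.
rewrite !mulmx1 !mul1mx J3 J3' J4.
by apply/matrixP=> i j; rewrite !mxE; ring.
Qed.

End Curve.

(** * Stationary points commute with the data matrix *)

Section Stationary.
Local Open Scope ring_scope.
Set Implicit Arguments.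
Unset Strict Implicit.
Variables (F : numFieldType) (n : nat).

Lemma flag_model_conj p k (b : 'I_p.+1 -> F) (V X : 'M[F]_n) :
  V^T *m V = 1%:M -> flag_model k b X -> flag_model k b (V *m X *m V^T).
Proof.
move=> VTV [Xsym Xb Xtr]; split.
- by rewrite !trmx_mul trmxK Xsym mulmxA.
- have conj s : \prod_(j <- s) (V *m X *m V^T - (b j)%:M) =
      V *m (\prod_(j <- s) (X - (b j)%:M)) *m V^T.
    elim: s => [|j s IHs].
      by rewrite !big_nil mulmx1 mulmx1C.
    rewrite !big_cons {}IHs.
    rewrite -[LHS]/(_ *m _) -[_ * \prod_(_ <- s) _]/(_ *m _) !mulmxA.
    congr (_ *m _ *m _).
    rewrite !mulmxBr !mulmxBl -!mulmxA VTV mulmx1; congr (_ - _).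
    by rewrite scalar_mxC.
  by rewrite conj Xb mulmx0 mul0mx.
- by rewrite mxtrace_mulC mulmxA VTV mul1mx.
Qed.

Lemma tangent_flag_commutator p k (b : 'I_p.+1 -> F) (X J : 'M[F]_n) :
    flag_model k b X -> J^T = - J -> J *m J *m J = - J ->
  tangent_space (@flag_model F p k n b) X (2%:R *: (J *m X - X *m J)).
Proof.
move=> VX JT J3.
have C0 : map_mx (horner_eval 0) (cayley J) = 1%:M.
  by rewrite cayley_eval expr0n /= mulr0 !scale0r !addr0.
have C'0 := cayley_deriv0 J; have Corth t := cayley_orthogonal t JT J3.
move: (cayley J) C0 C'0 Corth => C C0 C'0 Corth.
(* The rotation is [C] divided by 1 + t^2 and occurs twice in the conjugate, whence the square in
   [d]. The velocity at 0 is 2J X + X (2J)^T. *)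
pose N := C *m map_mx polyC X *m C^T.
pose d : {poly F} := (1 + 'X^2) ^+ 2.
have evX t : map_mx (horner_eval t) (map_mx polyC X) = X.
  by apply/matrixP=> i j; rewrite !mxE /horner_eval hornerC.
have evN t : map_mx (horner_eval t) N =
    map_mx (horner_eval t) C *m X *m (map_mx (horner_eval t) C)^T.
  by rewrite !map_mxM evX map_trmx.
have dt t : d.[t] = (1 + t ^+ 2) ^+ 2 by rewrite !hornerE.
have := @tangent_curve F n (@flag_model F p k n b) d N.
rewrite evN C0 mul1mx trmx1 mulmx1.
have -> : map_mx (horner_eval 0) (map_mx (@deriv F) N) =
    2%:R *: (J *m X - X *m J).
  rewrite !deriv_mulmx !(map_mxD, map_mxM) evX -!map_trmx C0 C'0.
  have -> : map_mx (horner_eval 0) (map_mx (@deriv F) (map_mx polyC X)) = 0.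
    by apply/matrixP=> i j; rewrite !mxE derivC /horner_eval horner0.
  rewrite mulmx0 addr0 trmx1 mulmx1 mul1mx linearZ /= JT.
  by rewrite -scalemxAl -scalemxAr mulmxN scalerBr scalerN.
apply.
- by rewrite dt expr0n addr0 expr1n.
- by rewrite !derivE !hornerE.
move=> t; rewrite dt => nz_t.
have nz1 : 1 + t ^+ 2 != 0 by move: nz_t; rewrite expf_eq0.
pose V := (1 + t ^+ 2)^-1 *: map_mx (horner_eval t) C.
have -> : ((1 + t ^+ 2) ^+ 2)^-1 *: map_mx (horner_eval t) N = V *m X *m V^T.
  rewrite evN /V linearZ /= -!scalemxAl -scalemxAr scalerA.
  by rewrite expr2 invfM.
apply: flag_model_conj => //.
rewrite /V !linearZ /= -scalemxAl scalerA Corth.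
by rewrite -scalemx1 scalerA -invfM -expr2 mulVf ?scale1r.
Qed.

Lemma tr_delta_mul (i j : 'I_n) (A : 'M[F]_n) : \tr (delta_mx i j *m A) = A j i.
Proof.
rewrite /mxtrace (bigD1 i) //= big1 => [|l ne_li]; rewrite mxE.
  rewrite (bigD1 j) //= big1 => [|m ne_mj]; rewrite mxE eqxx.
    by rewrite eqxx mul1r !addr0.
  by rewrite (negbTE ne_mj) mul0r.
by apply: big1 => m _; rewrite mxE (negbTE ne_li) mul0r.
Qed.

Lemma trace_commutator (J X A : 'M[F]_n) :
  \tr ((J *m X - X *m J) *m (X - A)) = \tr (J *m (A *m X - X *m A)).
Proof.
rewrite !mulmxBl !mulmxBr !raddfB /=.
rewrite -[X *m J *m X]mulmxA [\tr (X *m (J *m X))]mxtrace_mulC.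
rewrite -[X *m J *m A]mulmxA [\tr (X *m (J *m A))]mxtrace_mulC.
by rewrite !mulmxA; ring.
Qed.

(** The commutator [K] of two symmetric matrices is skew, so the elementary skew matrices detect all
    its entries through the trace pairing. *)
Lemma stationary_comm p k (b : 'I_p.+1 -> F) (A X : 'M[F]_n) :
  A^T = A -> stationary (@flag_model F p k n b) A X -> comm_mx A X.
Proof.
move=> AT [VX statX]; have [XT _ _] := VX.
suff K0 : A *m X - X *m A = 0 by apply/eqP; rewrite -subr_eq0 K0.
set K := A *m X - X *m A.
have KT : K^T = - K by rewrite linearB /= !trmx_mul AT XT opprB.
have Kij i j : K i j = - K j i by rewrite -[in LHS](trmxK K) KT !mxE.
apply/matrixP=> i j; rewrite [RHS]mxE.
have [<-|ne_ij] := eqVneq i j.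
  have /eqP := Kij i i; rewrite -subr_eq0 opprK -mulr2n.
  by rewrite mulrn_eq0 => /eqP.
(* This generates the rotations of one coordinate plane: [J *m J] is minus the projection onto that
   plane, so the cube is [- J]. The pairing with [K] gives -2 [K i j]. *)
pose J : 'M[F]_n := delta_mx i j - delta_mx j i.
have JT : J^T = - J by rewrite linearB /= !trmx_delta opprB.
have J3 : J *m J *m J = - J.
  have ne_ji : (j == i) = false by rewrite eq_sym; apply/negbTE.
  rewrite /J !(mulmxBl, mulmxBr) !mul_delta_mx_cond ne_ji (negbTE ne_ij) !eqxx.
  rewrite ?(mulr0n, mulr1n, subr0, sub0r, opprK, mulmxN, mulNmx).
  rewrite ?(mulmxBl, mulmxDl, mulNmx, mulmxBr) !mul_delta_mx_cond ne_ji (negbTE ne_ij) !eqxx.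
  rewrite !mul0mx !mulr0n !mulr1n. by rewrite !subr0 !sub0r opprK opprB addrC.
have := statX _ (tangent_flag_commutator VX JT J3).
have -> : (2%:R *: (J *m X - X *m J))^T = 2%:R *: (J *m X - X *m J).
  rewrite linearZ linearB /= !trmx_mul JT XT mulmxN mulNmx.
  by rewrite opprK addrC.
have -> : \tr (2%:R *: (J *m X - X *m J) *m (X - A)) = 2%:R * \tr (J *m K).
  rewrite -scalemxAl mxtraceZ; congr (_ * _).
  exact: trace_commutator.
rewrite mulmxBl raddfB /= !tr_delta_mul (Kij j i) -opprD -mulr2n.
move/eqP; rewrite mulf_eq0 pnatr_eq0 /= oppr_eq0 mulrn_eq0 /=.
by move/eqP.
Qed.

End Stationary.

(** * Eigenbasis computations and the converse criterion for stationarity *)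

Section Diagonal.
Local Open Scope ring_scope.
Set Implicit Arguments.
Unset Strict Implicit.
Variables (F : fieldType) (n : nat).
Implicit Types (P X Y A E : 'M[F]_n) (d l : 'rV[F]_n) (s : seq F).

Lemma comm_diag_mx l E : injective (l 0) ->
  comm_mx (diag_mx l) E -> E = diag_mx (\row_i E i i).
Proof.
move=> inj_l lE; apply/matrixP=> i j; rewrite !mxE.
have [<-|ne_ij] := eqVneq i j; first by rewrite mulr1n.
move/matrixP/(_ i j): lE; rewrite mul_diag_mx mul_mx_diag !mxE mulrC => /eqP.
rewrite -subr_eq0 -mulrBr mulf_eq0 subr_eq0 (inj_eq inj_l) (negbTE ne_ij) orbF.
by move=> /eqP ->; rewrite mulr0n.
Qed.

Lemma prod_conj_diag P d s : P \in unitmx ->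
  \prod_(c <- s) (invmx P *m diag_mx d *m P - c%:M) =
  invmx P *m diag_mx (\row_i \prod_(c <- s) (d 0 i - c)) *m P.
Proof.
move=> uP; elim: s => [|c s IHs].
  rewrite big_nil (_ : \row_i _ = const_mx 1) ?diag_const_mx ?mulmx1 ?mulVmx //.
  by apply/rowP=> i; rewrite !mxE big_nil.
rewrite big_cons {}IHs.
have -> : invmx P *m diag_mx d *m P - c%:M =
    invmx P *m diag_mx (d - const_mx c) *m P.
  rewrite linearB /= diag_const_mx mulmxBr mulmxBl; congr (_ - _).
  by rewrite scalar_mxC mulmxKV.
rewrite -[LHS]/(_ *m _) !mulmxA mulmxK //; congr (_ *m _).
rewrite -!mulmxA mulmx_diag; congr (_ *m diag_mx _).
by apply/rowP=> i; rewrite !mxE big_cons.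
Qed.

(** With indeterminate entries, a matrix equation becomes a family of polynomials to which [mxdiff]
    applies. *)
Definition generic_mx : 'M[{mpoly F[n * n]}]_n :=
  \matrix_(i, j) 'X_(mxvec_index i j).

Lemma eval_generic_mx X : map_mx (meval (mxcoord X)) generic_mx = X.
Proof. by apply/matrixP=> i j; rewrite !mxE mevalXU /mxcoord mxvecE. Qed.

Lemma eval_generic_prod X s :
  map_mx (meval (mxcoord X)) (\prod_(c <- s) (generic_mx - (c%:MP)%:M)) =
  \prod_(c <- s) (X - c%:M).
Proof.
elim: s => [|c s IHs]; first by rewrite !big_nil map_mx1.
rewrite !big_cons -IHs -[X in map_mx _ X]/(_ *m _) map_mxM map_mxB.
by rewrite eval_generic_mx map_scalar_mx /= mevalC.
Qed.

(** By induction on [s] with the product rule: in the eigenbasis of [X] the factors around [Y] are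
    diagonal, so on the diagonal the recursion is that of the derivative of the scalar product of
    the ['X - c%:P]. *)
Lemma mxdiff_generic_prod P X Y d s : P \in unitmx ->
    X = invmx P *m diag_mx d *m P -> forall i,
  (P *m map_mx (fun f => mxdiff f X Y)
          (\prod_(c <- s) (generic_mx - (c%:MP)%:M)) *m invmx P) i i =
  (\prod_(c <- s) ('X - c%:P))^`().[d 0 i] * (P *m Y *m invmx P) i i.
Proof.
move=> uP defX i; elim: s => [|c s IHs].
  rewrite !big_nil derivC horner0 mul0r.
  rewrite (_ : map_mx _ _ = 0) ?mulmx0 ?mul0mx ?mxE //.
  by apply/matrixP=> u v; rewrite !mxE -mpolyC_nat mxdiffC.
rewrite !big_cons.
have -> : map_mx (fun f => mxdiff f X Y) ((generic_mx - (c%:MP)%:M) *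
            \prod_(c <- s) (generic_mx - (c%:MP)%:M)) =
    Y *m (\prod_(c <- s) (X - c%:M)) + (X - c%:M) *m
    map_mx (fun f => mxdiff f X Y) (\prod_(c <- s) (generic_mx - (c%:MP)%:M)).
  set M := \prod_(_ <- s) (generic_mx - _); rewrite -eval_generic_prod -/M.
  apply/matrixP=> u v; rewrite !mxE.
  rewrite (big_morph (fun f => mxdiff f X Y) (mxdiffD X Y) (mxdiffC X Y 0)).
  rewrite -big_split; apply: eq_bigr => w _ /=.
  rewrite mxdiffM !mxE; congr (_ * _ + _ * _).
    rewrite -mulr_natr -mpolyC_nat -mpolyCM -mpolyCN mxdiffD mxdiffC addr0.
    by rewrite mxdiffU /mxcoord mxvecE.
  by rewrite mevalB mevalXU /mxcoord mxvecE mevalMn mevalC.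
rewrite defX prod_conj_diag // mulmxDr mulmxDl mxE.
have -> : P *m (Y *m (invmx P *m diag_mx (\row_j \prod_(c0 <- s) (d 0 j - c0)) *m P))
    *m invmx P = P *m Y *m invmx P *m diag_mx (\row_j \prod_(c0 <- s) (d 0 j - c0)).
  by rewrite !mulmxA mulmxK.
rewrite -defX; set D := map_mx _ _ in IHs *.
have -> : P *m ((X - c%:M) *m D) *m invmx P =
    diag_mx (d - const_mx c) *m (P *m D *m invmx P).
  rewrite !mulmxA; congr (_ *m _ *m _).
  rewrite [diag_mx _]linearB /= diag_const_mx mulmxBr mulmxBl; congr (_ - _).
    by rewrite defX !mulmxA mulmxV // mul1mx.
  by rewrite scalar_mxC.
move: (P *m D *m invmx P) (P *m Y *m invmx P) IHs => G H IHs.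
rewrite mul_mx_diag mul_diag_mx !mxE IHs.
rewrite derivM derivXsubC !hornerE horner_prod.
under [in RHS]eq_bigr do rewrite hornerXsubC.
by move=> /=; ring.
Qed.

Lemma comm_stationary p k (b : 'I_p.+1 -> F) P (A X : 'M[F]_n) (d l : 'rV[F]_n) :
    injective b -> P \in unitmx -> A^T = A ->
    A = invmx P *m diag_mx l *m P -> X = invmx P *m diag_mx d *m P ->
  flag_model k b X -> stationary (@flag_model F p k n b) A X.
Proof.
move=> inj_b uP AT defA defX VX; split=> // Y TY; have [XT Xb _] := VX.
pose s := [seq b j | j <- index_enum 'I_p.+1].
have s_prod Z : \prod_(j < p.+1) (Z - (b j)%:M) = \prod_(c <- s) (Z - c%:M) :> 'M[F]_n.
  by rewrite big_map.
have Yii i : (P *m Y *m invmx P) i i = 0.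
  (* Each entry of the matrix product is a polynomial vanishing on the model, so its differential
     kills the tangent vector [Y]. *)
  have D0 : map_mx (fun f => mxdiff f X Y)
      (\prod_(c <- s) (generic_mx - (c%:MP)%:M)) = 0.
    apply/matrixP=> u v; rewrite mxE [RHS]mxE; apply: TY => Z [_ Zb _].
    have /matrixP/(_ u v) := eval_generic_prod Z s.
    by rewrite mxE -s_prod Zb mxE.
  have := mxdiff_generic_prod Y s uP defX i.
  rewrite D0 mulmx0 mul0mx mxE => /esym/eqP; rewrite mulf_eq0 => /orP[q'0|/eqP //].
  have sep_q : separable_poly (\prod_(c <- s) ('X - c%:P)).
    by rewrite separable_prod_XsubC map_inj_uniq // index_enum_uniq.
  (* The product equation makes [d 0 i] a root of q; since q is separable, q' cannot vanish there
     too. *)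
  have q0 : root (\prod_(c <- s) ('X - c%:P)) (d 0 i).
    move: Xb; rewrite s_prod defX prod_conj_diag // => /(congr1 (fun M => P *m M *m invmx P)).
    rewrite !mulmxA mulmxV // mul1mx mulmxK // mulmx0 mul0mx.
    move=> /matrixP/(_ i i); rewrite !mxE eqxx mulr1n => di0.
    by rewrite /root horner_prod -di0; apply/eqP/eq_bigr=> c _; rewrite hornerXsubC.
  rewrite separable_poly.unlock in sep_q; have := coprimep_root sep_q q0.
  by rewrite q'0.
rewrite -mxtrace_tr trmx_mul trmxK linearB /= XT AT.
have -> : X - A = invmx P *m diag_mx (d - l) *m P.
  by rewrite defX defA [diag_mx (d - l)]linearB /= mulmxBr mulmxBl.
rewrite -!mulmxA mxtrace_mulC -!mulmxA mul_diag_mx.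
by apply: big1 => i _; rewrite mxE mulmxA Yii mulr0.
Qed.

End Diagonal.

(** * The multinomial coefficient as the number of permutations of a word *)

Section Multinomial.
Set Implicit Arguments.
Unset Strict Implicit.

Lemma sum_count_mem (T : finType) (s : seq T) : \sum_x count_mem x s = size s.
Proof.
elim: s => [|y s IHs]; first by rewrite big1.
rewrite /= big_split /= IHs (bigD1 y) //= eqxx big1 // => x ne_xy.
by rewrite eq_sym (negbTE ne_xy).
Qed.

(** A permutation of [s] is a first letter [x] followed by a permutation of [rem x s]. Removing [x]
    turns c! into (c - 1)!, and the missing factors c add up to the length of [s]. *)
Lemma size_permutations_multinomial (T : finType) (s : seq T) :
  size (permutations s) * \prod_x (count_mem x s)`! = (size s)`!.
Proof.
move Dn: (size s) => n; elim: n => [|n IHn] in s Dn *.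
  by rewrite (size0nil Dn) /= big1.
rewrite (perm_size (permutationsE _)) ?Dn // size_allpairs_dep sumnE big_map.
rewrite big_distrl /= factS -Dn -sum_count_mem big_distrl /=.
rewrite big_uniq ?undup_uniq //= [RHS](bigID (mem (undup s))) /=.
rewrite [X in _ = _ + X]big1 ?addn0 => [|x]; last first.
  by rewrite mem_undup => /count_memPn ->.
apply: eq_bigr => x; rewrite mem_undup => s_x.
rewrite -(IHn (rem x s)) ?size_rem ?Dn // mulnCA; congr (_ * _).
have ex := count_mem_rem x x s; rewrite eqxx in ex.
have cx : 0 < count_mem x s by rewrite -has_count has_pred1.
rewrite (bigD1 x) //= [in RHS](bigD1 x) //= ex mulnA; congr (_ * _).
  by rewrite -{1 2}(prednK cx) factS subn1 prednK.
by apply: eq_bigr => y ne_yx; rewrite count_mem_rem eq_sym (negbTE ne_yx) subn0.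
Qed.

End Multinomial.

(** * The discriminant and matrices with simple spectrum *)

Section Separable.
Local Open Scope ring_scope.
Set Implicit Arguments.
Unset Strict Implicit.

(** The shape of the Sylvester matrix depends on the degrees; nonzero images of the leading
    coefficients preserve it, and determinants commute with [f]. *)
Lemma rmorph_resultant (aR rR : nzRingType) (f : {rmorphism aR -> rR})
    (p q : {poly aR}) :
    f (lead_coef p) != 0 -> f (lead_coef q) != 0 ->
  f (resultant p q) = resultant (map_poly f p) (map_poly f q).
Proof.
move=> fp fq; rewrite /resultant /Sylvester_mx !size_map_poly_id0 //.
rewrite -det_map_mx map_col_mx; congr (\det (col_mx _ _));
  by apply: map_lin1_mx => v; rewrite map_poly_rV rmorphM /= map_rVpoly.
Qed.

Lemma separable_resultant (F : fieldType) (p : {poly F}) : p != 0 ->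
  separable_poly p = (resultant p p^`() != 0).
Proof.
move=> nz_p; rewrite separable_poly.unlock resultant_eq0 -leqNgt /coprimep.
have : gcdp p p^`() != 0 by rewrite gcdp_eq0 (negbTE nz_p).
by rewrite -size_poly_gt0 eqn_leq => ->; rewrite andbT.
Qed.

Lemma lead_coef_deriv_monic (R : nzRingType) (p : {poly R}) m :
  p \is monic -> size p = m.+2 -> m.+1%:R != 0 :> R -> lead_coef p^`() = m.+1%:R.
Proof.
move=> /monicP p1 szp nz_m.
have c : p^`()`_m = m.+1%:R.
  by rewrite coef_deriv -[p`_m.+1]/(p`_(m.+2.-1)) -szp -lead_coefE p1.
suff szp' : size p^`() = m.+1 by rewrite lead_coefE szp'.
apply/eqP; rewrite eqn_leq; apply/andP; split.
  by have := lt_size_deriv (p := p); rewrite szp; apply; rewrite -size_poly_gt0 szp.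
by rewrite ltnNge; apply: contra nz_m => /leq_sizeP/(_ _ (leqnn _)); rewrite c => ->.
Qed.

(** For positive [n] this is, up to sign, the discriminant of the characteristic polynomial, as a
    polynomial in the matrix entries. *)
Definition char_poly_disc (F : fieldType) n : {mpoly F[n * n]} :=
  resultant (char_poly (generic_mx F n)) (char_poly (generic_mx F n))^`().

Lemma char_poly_discP (F : numFieldType) n (A : 'M[F]_n) : (0 < n)%N ->
  ((char_poly_disc F n).@[mxcoord A] != 0) = separable_poly (char_poly A).
Proof.
case: n A => // n A _.
rewrite separable_resultant ?monic_neq0 ?char_poly_monic //; congr (_ != 0).
set G := char_poly (generic_mx F n.+1).
have Gm : G \is monic := char_poly_monic _.
have evn : (n.+1%:R : {mpoly F[n.+1 * n.+1]}).@[mxcoord A] != 0.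
  by rewrite rmorph_nat pnatr_eq0.
have Gl : lead_coef G^`() = n.+1%:R.
  apply: lead_coef_deriv_monic => //; first by rewrite size_char_poly.
  by apply: contraNneq evn => ->; rewrite meval0.
rewrite /char_poly_disc -/G rmorph_resultant; first last.
- by rewrite Gl.
- by rewrite (monicP Gm) rmorph1 oner_eq0.
by rewrite -deriv_map /G map_char_poly eval_generic_mx.
Qed.

Lemma char_poly_diag (R : comNzRingType) n (d : 'rV[R]_n) :
  char_poly (diag_mx d) = \prod_(i < n) ('X - (d 0 i)%:P).
Proof.
rewrite char_poly_trig ?diag_mx_is_trig //.
by apply: eq_bigr => i _; rewrite mxE eqxx.
Qed.

Lemma char_poly_conj (R : comNzRingType) n (P Q A : 'M[R]_n) : P *m Q = 1%:M ->
  char_poly (P *m A *m Q) = char_poly A.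
Proof.
move=> PQ; rewrite /char_poly.
have PQ' : map_mx polyC P *m map_mx polyC Q = 1%:M by rewrite -map_mxM PQ map_mx1.
have -> : char_poly_mx (P *m A *m Q) =
    map_mx polyC P *m char_poly_mx A *m map_mx polyC Q.
  rewrite /char_poly_mx mulmxBr mulmxBl !map_mxM; congr (_ - _).
  by rewrite -mulmxA -scalar_mxC mulmxA PQ' mul1mx.
by rewrite !det_mulmx mulrAC -det_mulmx PQ' det1 mul1r.
Qed.

Lemma separable_diag (F : fieldType) n (d : 'rV[F]_n) :
  separable_poly (char_poly (diag_mx d)) <-> injective (d 0).
Proof.
rewrite char_poly_diag -big_enum -(big_map (d 0) predT (fun x => 'X - x%:P)).
by rewrite separable_prod_XsubC; split=> /injectiveP.
Qed.

(** The minimal polynomial divides the characteristic one, hence a product of distinct linear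
    factors. *)
Lemma separable_diagonalizable (F : closedFieldType) n (A : 'M[F]_n) :
    (0 < n)%N -> separable_poly (char_poly A) ->
  exists P l, [/\ P \in unitmx, A = invmx P *m diag_mx l *m P & injective (l 0)].
Proof.
case: n A => // n A _ sepA; have [rs] := closed_field_poly_normal (char_poly A).
rewrite (monicP (char_poly_monic A)) scale1r => eA.
have : diagonalizable A.
  apply/diagonalizableP; exists rs; last by rewrite -eA mxminpoly_dvd_char.
  by rewrite -separable_prod_XsubC -eA.
case=> P uP /diagonalizable_forPex[l /(simmxLR uP)].
rewrite mxpoly.conjVmx // => eAl; exists P, l; split=> //.
by apply/separable_diag; rewrite -(char_poly_conj (diag_mx l) (mulVmx uP)) -eAl.
Qed.

(** The rows of [P] are eigenvectors of [A]. Their Gram matrix [P *m P^T] commutes with [diag_mx l],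
    so it is diagonal and commutes with [diag_mx d]; that is the claimed symmetry. [P] itself need
    not be orthogonal. *)
Lemma sym_eigenbasis (F : fieldType) n (P A : 'M[F]_n) (d l : 'rV[F]_n) :
    P \in unitmx -> A^T = A -> A = invmx P *m diag_mx l *m P ->
    injective (l 0) ->
  (invmx P *m diag_mx d *m P)^T = invmx P *m diag_mx d *m P.
Proof.
move=> uP AT eA inj_l.
have PA : P *m A = diag_mx l *m P by rewrite eA !mulmxA mulmxV // mul1mx.
have AP : A *m P^T = P^T *m diag_mx l.
  by rewrite -[in LHS]AT -trmx_mul PA trmx_mul tr_diag_mx.
have /(comm_diag_mx inj_l) : comm_mx (diag_mx l) (P *m P^T).
  by rewrite /comm_mx mulmxA -PA -!mulmxA AP.
set e := \row__ _ => eE.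
rewrite !trmx_mul tr_diag_mx trmx_inv.
apply: (can_inj (mulKmx uP)); rewrite !mulmxA eE mulmxV // mul1mx.
apply: (can_inj (mulmxK (_ : P^T \in unitmx))); rewrite ?unitmx_tr //.
by rewrite mulmxKV ?unitmx_tr // -mulmxA eE diag_mx_comm.
Qed.

End Separable.

(** * The word of block indices attached to the flag *)

Section Blocks.
Set Implicit Arguments.
Unset Strict Implicit.
Variables (p : nat) (k : nat -> nat).
Hypothesis k0 : k 0 = 0.
Hypothesis kS : forall j, j <= p -> k j < k j.+1.

(** The default [ord0] is never reached for [i < k p.+1], since the intervals then cover [i]. *)
Definition flag_block (i : nat) : 'I_p.+1 :=
  odflt ord0 [pick j : 'I_p.+1 | k j <= i < k j.+1].

Definition flag_blocks : seq 'I_p.+1 := [seq flag_block i | i <- iota 0 (k p.+1)].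

Lemma flag_index_mono a c : a <= c -> c <= p.+1 -> k a <= k c.
Proof.
elim: c => [|c IHc]; first by rewrite leqn0 => /eqP ->.
rewrite leq_eqVlt => /predU1P[-> //|le_ac] le_cp.
by apply: leq_trans (ltnW (kS _)); rewrite ?IHc // ltnW.
Qed.

Lemma flag_dim_gt0 : 0 < k p.+1.
Proof.
apply: leq_ltn_trans (leq0n (k 0)) _.
exact: leq_trans (kS (leq0n p)) (flag_index_mono _ _).
Qed.

Lemma flag_blockE (i : nat) (j : 'I_p.+1) :
  i < k p.+1 -> (k j <= i < k j.+1) = (j == flag_block i).
Proof.
move=> lt_i.
have ex : exists j : 'I_p.+1, k j <= i < k j.+1.
  (* Lowering [m] while [i < k m] ends at the right end of the interval of [i]; [k 0 = 0] excludes
     reaching [m = 0]. *)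
  have: forall m, m <= p.+1 -> i < k m -> exists2 j, j < m & k j <= i < k j.+1.
    elim=> [|m IHm] le_m; first by rewrite k0.
    have [lt_im _|le_mi lt_im] := ltnP i (k m); last by exists m; rewrite ?le_mi.
    by have [c lt_cm] := IHm (ltnW le_m) lt_im; exists c => //; apply: ltnW.
  by move=> /(_ _ (leqnn _) lt_i)[m lt_m im]; exists (Ordinal lt_m).
have uniq_block (j1 j2 : 'I_p.+1) :
    k j1 <= i < k j1.+1 -> k j2 <= i < k j2.+1 -> j1 <= j2.
  move=> /andP[le1 _] /andP[_ lt2]; rewrite leqNgt; apply/negP=> lt21.
  have := leq_trans lt2 (leq_trans (flag_index_mono lt21 (ltnW (ltn_ord j1))) le1).
  by rewrite ltnn.
rewrite /flag_block; case: pickP => [j0 ij0|no]; last first.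
  by case: ex => j1; rewrite no.
apply/idP/eqP=> [ij|-> //].
by apply/val_inj/eqP; rewrite eqn_leq !uniq_block.
Qed.

Lemma count_flag_blocks (j : 'I_p.+1) :
  count_mem j flag_blocks = k j.+1 - k j.
Proof.
rewrite count_map.
rewrite (eq_in_count (a2 := fun i => k j <= i < k j.+1)); last first.
  by move=> i; rewrite mem_iota => /= lt_i; rewrite flag_blockE // eq_sym.
have le1 : k j <= k j.+1 by apply: ltnW; apply: kS; rewrite -ltnS.
have le2 : k j.+1 <= k p.+1 by apply: flag_index_mono.
rewrite -sum1_count -[k p.+1]subn0 -/(index_iota 0 (k p.+1)).
rewrite -[RHS]muln1 -sum_nat_const_nat (@big_nat_widenl _ _ _ (k j) 0) //.
by rewrite (big_nat_widen _ _ _ _ _ le2); apply: eq_bigl => i; rewrite andbC.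
Qed.

Lemma size_flag_blocks : size flag_blocks = k p.+1.
Proof. by rewrite size_map size_iota. Qed.

End Blocks.

(** * Eigenvalues of the points of the model *)

Section Spectrum.
Local Open Scope ring_scope.
Set Implicit Arguments.
Unset Strict Implicit.
Variables (F : fieldType) (p : nat) (k : nat -> nat) (b : 'I_p.+1 -> F).
Hypothesis k0 : k 0 = 0%N.
Hypothesis kS : forall j, (j <= p)%N -> (k j < k j.+1)%N.
Local Notation n := (k p.+1).

(** Eigenvalue assignments are encoded as words of indices, so that those with prescribed
    multiplicities are the permutations of one word. *)
Definition spectrum_diag (m : nat) (t : seq 'I_p.+1) : 'M[F]_m :=
  diag_mx (\row_i b (nth ord0 t i)).

Lemma flag_diagE : flag_diag k n b = spectrum_diag n (flag_blocks p k).
Proof.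
congr diag_mx; apply/rowP=> i; rewrite !mxE.
rewrite (nth_map 0%N) ?size_iota // nth_iota // add0n.
by rewrite (eq_bigl _ _ (fun j => flag_blockE k0 kS j (ltn_ord i))) big_pred1_eq.
Qed.

Lemma trace_spectrum_diag (m : nat) t : size t = m ->
  \tr (spectrum_diag m t) = \sum_(j <- t) b j.
Proof.
move=> <-; rewrite mxtrace_diag (big_nth ord0) big_mkord.
by apply: eq_bigr => i _; rewrite mxE.
Qed.

Lemma sum_flag_blocks :
  \sum_(j <- flag_blocks p k) b j = \sum_(j < p.+1) (k j.+1 - k j)%:R * b j.
Proof.
have sum_count s : \sum_(j <- s) b j = \sum_j (count_mem j s)%:R * b j.
  elim: s => [|a s IHs]; first by rewrite big_nil big1 // => j _; rewrite mul0r.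
  rewrite big_cons IHs /=.
  under [in RHS]eq_bigr do rewrite natrD mulrDl.
  rewrite big_split /=; congr (_ + _).
  rewrite (bigD1 a) //= eqxx mul1r big1 ?addr0 // => j ne_ja.
  by rewrite eq_sym (negbTE ne_ja) mul0r.
by rewrite sum_count; apply: eq_bigr => j _; rewrite count_flag_blocks.
Qed.

(** Every diagonal entry is some [b j], so the product equation holds automatically and only the
    trace is left. *)
Lemma flag_model_spectrum (P : 'M[F]_n) t : P \in unitmx -> size t = n ->
    (invmx P *m spectrum_diag n t *m P)^T = invmx P *m spectrum_diag n t *m P ->
  flag_model k b (invmx P *m spectrum_diag n t *m P) <->
  \sum_(j <- t) b j = \sum_(j < p.+1) (k j.+1 - k j)%:R * b j.
Proof.
move=> uP szt symX.
have trX : \tr (invmx P *m spectrum_diag n t *m P) = \sum_(j <- t) b j.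
  by rewrite mxtrace_mulC mulmxA mulmxV // mul1mx trace_spectrum_diag.
split=> [[_ _]|sum_t]; first by rewrite trX.
split=> //; last by rewrite trX.
have := prod_conj_diag (\row_i b (nth ord0 t i)) [seq b j | j <- index_enum 'I_p.+1] uP.
rewrite big_map => ->.
rewrite (_ : \row_i _ = 0) ?linear0 ?mulmx0 ?mul0mx //.
apply/rowP=> i; rewrite !mxE big_map (bigD1 (nth ord0 t i)) //=.
by rewrite subrr mul0r.
Qed.

Lemma flag_model_spectrumP (P : 'M[F]_n) (d : 'rV_n) : P \in unitmx ->
    flag_model k b (invmx P *m diag_mx d *m P) ->
  exists2 t, size t = n & diag_mx d = spectrum_diag n t.
Proof.
move=> uP [_ Xb _].
have := prod_conj_diag d [seq b j | j <- index_enum 'I_p.+1] uP.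
rewrite big_map Xb => /(congr1 (fun M => P *m M *m invmx P)).
rewrite !mulmxA mulmxV // mul1mx mulmxK // mulmx0 mul0mx => /matrixP D0.
have ex i : exists j, d 0 i == b j.
  have /esym := D0 i i; rewrite !mxE eqxx mulr1n big_map => /eqP.
  by rewrite prodf_seq_eq0 => /hasP[j _]; rewrite subr_eq0; exists j.
exists [seq xchoose (ex i) | i <- enum 'I_n].
  by rewrite size_map size_enum_ord.
congr diag_mx; apply/rowP=> i; rewrite !mxE (nth_map i) ?size_enum_ord //.
by rewrite nth_ord_enum; apply/eqP/(xchooseP (ex i)).
Qed.

Lemma char_poly_spectrum_diag (m : nat) t : size t = m ->
  char_poly (spectrum_diag m t) = \prod_(x <- map b t) ('X - x%:P).
Proof.
move=> <-; rewrite char_poly_diag big_map (big_nth ord0) big_mkord.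
by apply: eq_bigr => i _; rewrite mxE.
Qed.

End Spectrum.

(** * The trace equation fixes the multiplicities *)

Section Multiplicities.
Local Open Scope ring_scope.
Set Implicit Arguments.
Unset Strict Implicit.
Variables (F : fieldType) (p : nat) (k : nat -> nat) (b : 'I_p.+1 -> F).
Hypothesis k0 : k 0 = 0%N.
Hypothesis kS : forall j, (j <= p)%N -> (k j < k j.+1)%N.
Local Notation n := (k p.+1).

(** The diagonal matrix of [t] lies in the model, hence in the orbit, so it has the characteristic
    polynomial of [flag_diag]. Equal products of linear factors have the same roots up to order. *)
Lemma perm_flag_blocks : injective b ->
    (forall X : 'M[F]_n, flag_model k b X -> flag_orbit k b X) ->
  forall t, size t = n ->
    \sum_(j <- t) b j = \sum_(j < p.+1) (k j.+1 - k j)%:R * b j ->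
  perm_eq t (flag_blocks p k).
Proof.
move=> inj_b model t szt sum_t; apply: (perm_map_inj inj_b).
apply: prod_XsubC_eq.
have := @flag_model_spectrum F p k b 1%:M t (unitmx1 _ _) szt.
rewrite invmx1 mul1mx mulmx1 tr_diag_mx => /(_ erefl)[_ /(_ sum_t)/model].
case=> V [VTV eqV].
rewrite -!(@char_poly_spectrum_diag F p b n) ?size_flag_blocks // eqV.
by rewrite char_poly_conj ?flag_diagE // mulmx1C.
Qed.

End Multiplicities.

(** * Counting the stationary points *)

Section Count.
Local Open Scope ring_scope.
Set Implicit Arguments.
Unset Strict Implicit.
Variables (F : numClosedFieldType) (p : nat) (k : nat -> nat) (b : 'I_p.+1 -> F).
Hypothesis k0 : k 0 = 0%N.
Hypothesis kS : forall j, (j <= p)%N -> (k j < k j.+1)%N.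
Local Notation n := (k p.+1).

Lemma card_stationary (A : 'M[F]_n) :
    injective b ->
    (forall t, size t = n ->
      \sum_(j <- t) b j = \sum_(j < p.+1) (k j.+1 - k j)%:R * b j ->
      perm_eq t (flag_blocks p k)) ->
    A^T = A -> separable_poly (char_poly A) ->
  has_card (stationary (@flag_model F p k n b) A)
    (n`! %/ \prod_(j < p.+1) (k j.+1 - k j)`!).
Proof.
move=> inj_b permP AT sepA.
have n_gt0 : (0 < n)%N by apply: flag_dim_gt0.
have [P [l [uP eA inj_l]]] := separable_diagonalizable n_gt0 sepA.
pose X t : 'M[F]_n := invmx P *m spectrum_diag b n t *m P.
have symX t : (X t)^T = X t by apply: sym_eigenbasis eA inj_l.
(* Distinct words give distinct matrices because [P] is invertible and [b] is injective. *)
exists (map X (permutations (flag_blocks p k))); split.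
- rewrite map_inj_in_uniq ?permutations_uniq // => t1 t2.
  rewrite !mem_permutations => /perm_size + /perm_size.
  rewrite size_flag_blocks => sz1 sz2 /(can_inj (mulmxK uP)).
  move=> /(can_inj (mulKmx _)) eX; apply: (@eq_from_nth _ ord0).
    by rewrite sz1 sz2.
  move=> i; rewrite sz1 => lt_i.
  have /matrixP/(_ (Ordinal lt_i) (Ordinal lt_i)) : spectrum_diag b n t1 = spectrum_diag b n t2.
    by apply: eX; rewrite unitmx_inv.
  by rewrite !mxE eqxx => /inj_b.
- rewrite size_map -(size_flag_blocks p k) -size_permutations_multinomial.
  rewrite (eq_bigr _ (fun j _ => congr1 factorial (count_flag_blocks k0 kS j))).
  by rewrite mulnK // prodn_gt0 // => j; apply: fact_gt0.
move=> Z; split=> [/mapP[t + ->]|statZ].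
  rewrite mem_permutations => tP.
  have szt : size t = n by rewrite (perm_size tP) size_flag_blocks.
  apply: (comm_stationary inj_b uP AT eA (erefl _)).
  apply/flag_model_spectrum => //; first exact: symX.
  by rewrite (perm_big _ tP) sum_flag_blocks.
have AZ := stationary_comm AT statZ; have [VZ _] := statZ.
(* As [A] has simple spectrum, everything commuting with it is diagonal in its eigenbasis. *)
have eZ : Z = invmx P *m diag_mx (\row_i (P *m Z *m invmx P) i i) *m P.
  rewrite -(@comm_diag_mx F n l) //; first by rewrite !mulmxA mulVmx // mul1mx mulmxKV.
  move: AZ; rewrite eA /comm_mx => /(congr1 (fun M => P *m M *m invmx P)).
  by rewrite !mulmxA mulmxV // mul1mx mulmxK //.
have VZ' := VZ; rewrite {}eZ in VZ' *.
have [t szt et] := flag_model_spectrumP uP VZ'.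
rewrite et in VZ' *; apply/mapP; exists t => //; rewrite mem_permutations.
apply: permP => //; apply/(flag_model_spectrum uP szt (symX t)).
exact: VZ'.
Qed.

End Count.

Theorem theorem3p3 (R : realType) (p n : nat) (k : nat -> nat)
    (b : 'I_p.+1 -> R)
    (hk0 : k 0 = 0)
    (hk : forall j : nat, j <= p -> k j < k j.+1)
    (hkn : k p.+1 = n)
    (hb : injective b)
    (* The two descriptions of the model coincide, i.e. the trace condition
       determines the multiplicities of the eigenvalues b j. *)
    (hmodel : forall X : 'M[R]_n, flag_model k b X <-> flag_orbit k b X) :
  ED_degree (@flag_complex_locus R p k n b)
    (n`! %/ \prod_(j < p.+1) (k j.+1 - k j)`!).
Proof.
subst n.
have n_gt0 : 0 < k p.+1 by apply: flag_dim_gt0.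
exists (char_poly_disc R (k p.+1)); split=> [|A AT].
  (* A symmetric matrix with distinct eigenvalues 0, ..., n - 1 shows that the discriminant is not
     identically zero there. *)
  exists (diag_mx (\row_i (i%:R)%R)); split; first by rewrite tr_diag_mx.
  rewrite char_poly_discP //; apply/separable_diag => i j /eqP.
  by rewrite !mxE eqr_nat => /eqP/val_inj.
rewrite char_poly_discP // => sepA; apply: card_stationary => //.
- by move=> i j /complexI/hb.
(* [hmodel] concerns real matrices; the complex trace equation involves only real numbers and
   descends by injectivity of the embedding. *)
- move=> t szt sum_t; apply: (perm_flag_blocks hk0 hk hb) => // [X /hmodel //|].
  apply: (@complexI R).
  rewrite rmorph_sum sum_t rmorph_sum; apply: eq_bigr => j _.
  by rewrite rmorphM rmorph_nat.
- by rewrite map_trmx AT.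
- by rewrite -map_char_poly separable_map.
Qed.
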